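(* Let $\mathcal{E}$ be a finite dimensional $\mathfrak{B}$-submodule of $C^\infty(\mathbb{R}^+\times\mathbb{R})\otimes_{\mathbb{R}}\mathbb{C}$. \begin{enumerate} \item If $f\in\mathcal{E}$, then $f=\sum_{\alpha,i,j}c_{\alpha,i,j}(x^1)^\alpha(\log(x^1))^i(x^2)^j$, where in this finite sum $c_{\alpha,i,j}\in\mathbb{C}$, $\alpha\in\mathbb{C}$, and $i$ and $j$ are non-negative integers. \item If $\dim\{\mathcal{E}\}=1$, then $\mathcal{E}=\operatorname{Span}_{\mathbb{C}}\{(x^1)^a\}$ for some $a\in\mathbb{C}$. \item If $\dim\{\mathcal{E}\}=2$, then one of the following possibilities holds, for some $\alpha,\beta,c_1\in\mathbb{C}$: (a) $\mathcal{E}=\operatorname{Span}_{\mathbb{C}}\{(x^1)^\alpha,(x^1)^\alpha(c_1x^1+x^2)\}$; (b) $\mathcal{E}=\operatorname{Span}_{\mathbb{C}}\{(x^1)^\alpha,(x^1)^\alpha\log(x^1)\}$; (c) $\mathcal{E}=\operatorname{Span}_{\mathbb{C}}\{(x^1)^\alpha,(x^1)^\beta\}$ with $\alpha\neq\beta$. \end{enumerate}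
   Context: $(x^1,x^2)$ are the coordinates on $\mathbb{R}^+\times\mathbb{R}$, so $x^1>0$, and $(x^1)^\alpha=e^{\alpha\log(x^1)}$ for $\alpha\in\mathbb{C}$. $\mathfrak{B}$ is the unital non-commutative algebra of differential operators generated by the vector fields $\partial_{x^2}$ and $X:=x^1\partial_{x^1}+x^2\partial_{x^2}$. A finite dimensional $\mathfrak{B}$-submodule of $C^\infty(\mathbb{R}^+\times\mathbb{R})\otimes_{\mathbb{R}}\mathbb{C}$ (the complex-valued smooth functions) is a finite dimensional complex linear subspace invariant under $\partial_{x^2}$ and $X$; $\dim$ is complex dimension. *)

(* Defs.v *)
From HB Require Import structures.
From mathcomp Require Import all_boot all_order all_algebra.
From mathcomp Require Import complex.
From mathcomp Require Import all_classical all_reals all_analysis.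
Set Implicit Arguments.
Unset Strict Implicit.
Unset Printing Implicit Defensive.
Import Order.TTheory GRing.Theory Num.Theory numFieldNormedType.Exports.
Local Open Scope classical_set_scope.
Local Open Scope complex_scope.
Local Open Scope ring_scope.

Definition half_plane (R : realType) : Type := {p : R * R | 0 < p.1}.

Definition x1 (R : realType) (p : half_plane R) : R := (val p).1.
Definition x2 (R : realType) (p : half_plane R) : R := (val p).2.

(* Extension by 0 to the plane.  The half-plane is open, so continuity and
   derivatives at its points do not depend on the values chosen outside. *)
Definition extend (R : realType) (u : half_plane R -> R) : R * R -> R :=
  fun q => oapp u 0 (insub q).

Definition e1 (R : realType) : R * R := (1, 0).
Definition e2 (R : realType) : R * R := (0, 1).

Definition pderiv (R : realType) (v : R * R) (u : half_plane R -> R) :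
  half_plane R -> R := fun p => 'D_v (extend u) (val p).

Definition has_pderiv (R : realType) (v : R * R) (u : half_plane R -> R) :
  Prop := forall p : half_plane R, derivable (extend u) (val p) v.

(* u and its iterated partial derivatives up to order k exist and are
   continuous on the half-plane. *)
Fixpoint Ck (R : realType) (k : nat) (u : half_plane R -> R) : Prop :=
  (forall p : half_plane R, {for val p, continuous (extend u)}) /\
  (if k is k'.+1 then
     [/\ has_pderiv (e1 R) u, has_pderiv (e2 R) u,
         Ck k' (pderiv (e1 R) u) & Ck k' (pderiv (e2 R) u)]
   else True).

Definition smooth (R : realType) (u : half_plane R -> R) : Prop :=
  forall k, Ck k u.

Definition Re_fun (R : realType) (f : half_plane R -> R[i]) :
  half_plane R -> R := fun p => complex.Re (f p).
Definition Im_fun (R : realType) (f : half_plane R -> R[i]) :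
  half_plane R -> R := fun p => complex.Im (f p).

(* An element of C^oo(R^+ x R) tensored with C over R is u + i v, with u and v
   real smooth functions. *)
Definition csmooth (R : realType) (f : half_plane R -> R[i]) : Prop :=
  smooth (Re_fun f) /\ smooth (Im_fun f).

Definition cpderiv (R : realType) (v : R * R) (f : half_plane R -> R[i]) :
  half_plane R -> R[i] :=
  fun p => pderiv v (Re_fun f) p +i* pderiv v (Im_fun f) p.

(* The vector field d/dx^2, where 2 is a coordinate index. *)
Definition d2 (R : realType) (f : half_plane R -> R[i]) :
  half_plane R -> R[i] := cpderiv (e2 R) f.

(* X = x^1 d/dx^1 + x^2 d/dx^2 *)
Definition Xop (R : realType) (f : half_plane R -> R[i]) :
  half_plane R -> R[i] :=
  fun p => (x1 p)%:C * cpderiv (e1 R) f p + (x2 p)%:C * cpderiv (e2 R) f p.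

Definition Clinear_subspace (R : realType) (E : set (half_plane R -> R[i])) :
  Prop := GRing.submod_closed (R := R[i]) [in E].

(* Invariance under the generators d2 and X amounts to invariance under the
   whole unital algebra B. *)
Definition Bsubmodule (R : realType) (E : set (half_plane R -> R[i])) : Prop :=
  [/\ Clinear_subspace E,
      forall f, E f -> csmooth f,
      forall f, E f -> E (d2 f) &
      forall f, E f -> E (Xop f)].

Definition Cspan (R : realType) (s : seq (half_plane R -> R[i])) :
  set (half_plane R -> R[i]) :=
  [set f | exists c : 'I_(size s) -> R[i], f = \sum_i c i *: s`_i].

Definition Cfree (R : realType) (s : seq (half_plane R -> R[i])) : Prop :=
  forall c : 'I_(size s) -> R[i],
    \sum_i c i *: s`_i = 0 -> forall i, c i = 0.

Definition Cdim (R : realType) (E : set (half_plane R -> R[i])) (n : nat) :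
  Prop := exists s, [/\ size s = n, Cfree s & E = Cspan s].

Definition Cfinite_dim (R : realType) (E : set (half_plane R -> R[i])) : Prop :=
  exists n, Cdim E n.

Definition cexp (R : realType) (z : R[i]) : R[i] :=
  (expR (complex.Re z) * cos (complex.Im z)) +i*
  (expR (complex.Re z) * sin (complex.Im z)).

Definition x1pow (R : realType) (alpha : R[i]) : half_plane R -> R[i] :=
  fun p => cexp (alpha * (ln (x1 p))%:C).

(* Main.v *)
Require Import Defs.
From HB Require Import structures.
From mathcomp Require Import all_boot all_order all_algebra.
From mathcomp Require Import complex.
From mathcomp Require Import all_classical all_reals all_analysis.
From mathcomp Require Import ring lra.
Set Implicit Arguments.
Unset Strict Implicit.
Unset Printing Implicit Defensive.
Import Order.TTheory GRing.Theory Num.Theory numFieldNormedType.Exports.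
Local Open Scope classical_set_scope.
Local Open Scope complex_scope.
Local Open Scope ring_scope.

(* Since [d2, X] = d2, the operator d2 lowers eigenvalues of X by 1, so on a
   finite dimensional module it cannot act indefinitely.  Hence, modulo any
   invariant subspace S not containing E, there is a common eigenvector: some
   g in E, not in S, with d2 g and (X - a) g in S.  Taking for S the span of
   the functions (x^1)^a (log x^1)^i (x^2)^j, which is stable under integration
   of d2 and of X - a, gives the first claim.  For dim E = 1 take S = 0; the
   homogeneous equations d2 g = 0, X g = a g have only the solutions
   g = c (x^1)^a.  For dim E = 2 take S = 0, then S = Span (x^1)^a, and subtract
   an explicit particular solution. *)

(** * Partial derivatives on the half-plane and symmetry of mixed ones *)

Section PartialDerivatives.
Variable R : realType.
Implicit Types (U : R * R -> R) (u w : half_plane R -> R).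

(** A directional derivative sees only the restriction to a line, so equal restrictions give equal
    difference quotients. This reduces partial derivatives in the plane to derivatives in one
    variable. *)
Lemma is_derive_along (K : numFieldType) (V V' W : normedModType K)
    (f : V -> W) (g : V' -> W) (a v : V) (x y : V') (d : W) :
  (forall h : K, f (h *: v + a) = g (h *: y + x)) ->
  is_derive a v f d -> is_derive x y g d.
Proof.
move=> E; have E0 : f a = g x by have := E 0; rewrite !scale0r !add0r.
have Eq : (fun h : K => h^-1 *: ((f \o shift a) (h *: v) - f a)) =
          (fun h : K => h^-1 *: ((g \o shift x) (h *: y) - g x)).
  by apply/funext => h /=; rewrite E E0.
by move=> -[]; rewrite /derivable /derive Eq => h1 h2; split.
Qed.

Lemma is_derive_slice1 U (s t d : R) :
  is_derive (s, t) (e1 R) U d <-> is_derive s (1 : R) (fun r => U (r, t)) d.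
Proof.
have E (h : R) : U (h *: e1 R + (s, t)) = U (h *: (1 : R) + s, t).
  rewrite (_ : h *: e1 R + (s, t) = (h *: (1 : R) + s, h *: (0 : R) + t)) //.
  by rewrite scaler0 add0r.
by split; apply: is_derive_along.
Qed.

Lemma is_derive_slice2 U (s t d : R) :
  is_derive (s, t) (e2 R) U d <-> is_derive t (1 : R) (fun r => U (s, r)) d.
Proof.
have E (h : R) : U (h *: e2 R + (s, t)) = U (s, h *: (1 : R) + t).
  rewrite (_ : h *: e2 R + (s, t) = (h *: (0 : R) + s, h *: (1 : R) + t)) //.
  by rewrite scaler0 add0r.
by split; apply: is_derive_along.
Qed.

Lemma MVT_cc (f df : R -> R) (a b : R) : a <= b ->
  (forall x, a <= x <= b -> is_derive x 1 f (df x)) ->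
  exists2 c, a <= c <= b & f b - f a = df c * (b - a).
Proof.
move=> ab fd; have [x||c] := @MVT_segment R f df a b ab.
- by rewrite in_itv /= => /andP[ax xb]; apply: fd; rewrite !ltW.
- apply: derivable_within_continuous => x; rewrite in_itv /= => xab.
  by have [] := fd x xab.
- by rewrite in_itv /= => cab ->; exists c.
Qed.

(** The mean value theorem is applied twice: in [s] to the difference of the slices of [U] at
    [b + k] and [b], then in [t] to [U1 s] at the point [s] so obtained. *)
Lemma double_difference (U U1 U12 : R -> R -> R) (a b h k : R) :
  0 <= h -> 0 <= k ->
  (forall s t, a <= s <= a + h -> b <= t <= b + k ->
     is_derive s 1 (U^~ t) (U1 s t)) ->
  (forall s t, a <= s <= a + h -> b <= t <= b + k ->
     is_derive t 1 (U1 s) (U12 s t)) ->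
  exists s t, [/\ a <= s <= a + h, b <= t <= b + k &
    U (a + h) (b + k) - U (a + h) b - U a (b + k) + U a b = U12 s t * h * k].
Proof.
move=> h0 k0 H1 H12.
have bk : b <= b + k <= b + k by rewrite lerDl k0 lexx.
have bb : b <= b <= b + k by rewrite lerDl k0 lexx.
have ah : a <= a + h by rewrite lerDl.
have [s sa] := @MVT_cc (fun s => U s (b + k) - U s b)
  (fun s => U1 s (b + k) - U1 s b) a (a + h) ah
  (fun s hs => is_deriveB (H1 s _ hs bk) (H1 s _ hs bb)).
have bk' : b <= b + k by rewrite lerDl.
have [t tb] := @MVT_cc (U1 s) (U12 s) b (b + k) bk' (fun t ht => H12 s t sa ht).
rewrite ![_ + _ - a]addrC ![_ + _ - b]addrC !addKr => E2 E1.
exists s, t; split=> //; rewrite mulrAC -E2 -E1; ring.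
Qed.

Lemma near_pos (q : R * R) : 0 < q.1 -> \forall z \near q, 0 < z.1.
Proof.
case: q => s t /= s0; exists ([set x : R | 0 < x], setT) => /=.
  by split; [exact: lt_nbhsr | exact: filterT].
by case=> ? ? [].
Qed.

Definition point (s t : R) (s0 : 0 < s) : half_plane R :=
  exist (fun q : R * R => 0 < q.1) (s, t) s0.

Lemma pointE (p : half_plane R) : exists s t (s0 : 0 < s), p = point t s0.
Proof. by case: p => -[s t] /= s0; exists s, t, s0. Qed.

Lemma extendE u p : extend u (val p) = u p.
Proof. by rewrite /extend valK. Qed.

Lemma extend_point u (s t : R) (s0 : 0 < s) : extend u (s, t) = u (point t s0).
Proof. by rewrite -extendE. Qed.

Lemma near_extend u (U : R * R -> R) (p : half_plane R) :
  (forall q : half_plane R, u q = U (val q)) -> {near val p, extend u =1 U}.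
Proof.
move=> uU; have := near_pos (valP p); apply: filterS => -[s t] /= s0.
by rewrite (extend_point _ _ s0) uU.
Qed.

Lemma is_derive_extend u (U : R * R -> R) (p : half_plane R) v d :
  (forall q : half_plane R, u q = U (val q)) -> is_derive (val p) v U d ->
  is_derive (val p) v (extend u) d.
Proof.
move=> uU [h1 h2]; have N := near_extend p uU; split.
  by apply: near_eq_derivable h1; apply: filterS N.
by rewrite -h2; apply: near_eq_derive.
Qed.

(** The half-plane contains the whole vertical line through each of its points, so the criterion for
    functions on all of [R] applies. *)
Lemma const_of_pderiv2_0 u (a b b' : R) (a0 : 0 < a) :
  (forall p : half_plane R, is_derive (val p) (e2 R) (extend u) 0) ->
  u (point b a0) = u (point b' a0).
Proof.
move=> H; rewrite -2!extend_point.
apply: (@is_derive_0_is_cst R (fun t => extend u (a, t))) => t.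
by apply/is_derive_slice2; apply: (H (point t a0)).
Qed.

(** Move vertically to a common second coordinate, then horizontally; the horizontal segment has
    positive first coordinates, and the mean value theorem applies on it. *)
Lemma const_of_pderiv0 u :
  (forall p : half_plane R, is_derive (val p) (e1 R) (extend u) 0) ->
  (forall p : half_plane R, is_derive (val p) (e2 R) (extend u) 0) ->
  forall p q, u p = u q.
Proof.
move=> H1 H2 p q.
have [a [b [a0 ->]]] := pointE p; have [a' [b' [a0' ->]]] := pointE q.
rewrite (const_of_pderiv2_0 b b' a0 H2) -2!extend_point.
wlog aa : a a' a0 a0' / a <= a'.
  by move=> W; case: (leP a a') => [|/ltW] le; [|symmetry]; apply: W.
have D s : a <= s <= a' -> is_derive s 1 (fun s => extend u (s, b')) 0.
  move=> /andP[as_ _]; apply/is_derive_slice1.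
  exact: (H1 (point b' (lt_le_trans a0 as_))).
have [c _ /eqP] := MVT_cc aa D.
by rewrite mul0r subr_eq0 => /eqP.
Qed.

Lemma ball_box (a b r s t : R) : 0 < r -> a <= s <= a + r / 2 ->
  b <= t <= b + r / 2 -> ball (a, b) r (s, t).
Proof.
move=> r0 /andP[? ?] /andP[? ?].
by split; rewrite /ball /= ltr_distlC; apply/andP; split; lra.
Qed.

Lemma dist_le (x y m m' e : R) : m = m' ->
  `|x - m| < e / 2 -> `|y - m'| < e / 2 -> `|x - y| <= e.
Proof.
move=> -> A1 A2; rewrite (splitr e); apply/ltW; apply: le_lt_trans (ltrD A1 A2).
rewrite [X in _ <= _ + X]distrC; apply: le_trans (ler_normD _ _).
by rewrite addrA subrK.
Qed.

(** The double difference over a small box with corner [p] is symmetric in the two variables. Its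
    two mean value expressions equate the mixed derivatives at two points near [p], and continuity
    at [p] makes their values at [p] differ by at most any [e > 0]. *)
Lemma schwarz u (p : half_plane R) : Ck 2 u ->
  pderiv (e2 R) (pderiv (e1 R) u) p = pderiv (e1 R) (pderiv (e2 R) u) p.
Proof.
move=> [_ [d1 d2 [_ [_ d12 _ [c12 _]]] [_ [d21 _ [c21 _] _]]]].
apply/eqP; rewrite -subr_eq0 -normr_le0; apply/ler_addgt0Pr => e e0; rewrite add0r.
have e20 : 0 < e / 2 by rewrite divr_gt0.
have near_dist w : {for val p, continuous (extend w)} ->
    \forall z \near val p, `|w p - extend w z| < e / 2.
  by move=> cw; rewrite -(extendE w p); apply: (@cvgr_dist_lt _ _ _ _ _ _ _ cw).
have N12 := near_dist _ (c12 p); have N21 := near_dist _ (c21 p).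
(* On the ball of radius [r] both mixed derivatives are within [e / 2] of their values at [p]; a box
   of side [r / 2] fits inside it. *)
have [r /= r0 N] := (nbhs_ballP _ _).1 (filterI N12 N21).
have [a [b [a0 pE]]] := pointE p.
have h0 : 0 < r / 2 by rewrite divr_gt0.
have S1 v (w : half_plane R -> R) s t : has_pderiv v w -> a <= s ->
    is_derive (s, t) v (extend w) (extend (pderiv v w) (s, t)).
  move=> dw as_; have s0 := lt_le_trans a0 as_.
  by rewrite (extend_point _ _ s0); apply/derivableP/(dw (point t s0)).
have [s [t [sa tb E]]] := @double_difference
  (fun s t => extend u (s, t)) (fun s t => extend (pderiv (e1 R) u) (s, t))
  (fun s t => extend (pderiv (e2 R) (pderiv (e1 R) u)) (s, t))
  a b (r / 2) (r / 2) (ltW h0) (ltW h0)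
  (fun s t sa _ => (is_derive_slice1 _ _ _ _).1 (S1 _ _ s t d1 (andP sa).1))
  (fun s t sa _ => (is_derive_slice2 _ _ _ _).1 (S1 _ _ s t d12 (andP sa).1)).
have [t' [s' [tb' sa' E']]] := @double_difference
  (fun t s => extend u (s, t)) (fun t s => extend (pderiv (e2 R) u) (s, t))
  (fun t s => extend (pderiv (e1 R) (pderiv (e2 R) u)) (s, t))
  b a (r / 2) (r / 2) (ltW h0) (ltW h0)
  (fun t s _ sa => (is_derive_slice2 _ _ _ _).1 (S1 _ _ s t d2 (andP sa).1))
  (fun t s _ sa => (is_derive_slice1 _ _ _ _).1 (S1 _ _ s t d21 (andP sa).1)).
rewrite pE in N *.
have [A1 _] := N _ (ball_box r0 sa tb); have [_ A2] := N _ (ball_box r0 sa' tb').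
have EE : extend (pderiv (e2 R) (pderiv (e1 R) u)) (s, t) =
          extend (pderiv (e1 R) (pderiv (e2 R) u)) (s', t').
  (* Both sides of the box have length [r / 2], so this nonzero factor is cancelled twice. *)
  apply: (mulIf (lt0r_neq0 h0)); apply: (mulIf (lt0r_neq0 h0)).
  by apply: (etrans (esym E)); apply: etrans E'; congr (_ + _); apply: addrAC.
exact: (dist_le EE A1 A2).
Qed.

End PartialDerivatives.

(** * Complex derivatives, the operators [d2] and [X], and their common eigenfunctions *)

Section ComplexOperators.
Variable R : realType.
Local Notation C := R[i].
Local Notation F := (half_plane R -> R[i]).
Implicit Types (f g h : F) (p : half_plane R) (a : C).

(** A relation rather than a function: it records that the derivative exists along with its value,
    so the rules of calculus carry no derivability side conditions. *)
Definition is_cderive (v : R * R) f g := forall p,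
  is_derive (val p) v (extend (Re_fun f)) (complex.Re (g p)) /\
  is_derive (val p) v (extend (Im_fun f)) (complex.Im (g p)).

Lemma is_cderive_cpderiv v f g : is_cderive v f g -> cpderiv v f = g.
Proof.
move=> H; apply/funext => p; rewrite /cpderiv /pderiv.
by have [[_ ->] [_ ->]] := H p; case: (g p).
Qed.

Lemma is_cderive_has_pderiv v f : has_pderiv v (Re_fun f) ->
  has_pderiv v (Im_fun f) -> is_cderive v f (cpderiv v f).
Proof. by move=> hr hi p; split; apply/derivableP; [apply: hr|apply: hi]. Qed.

Section RealProducts.
Variables (U V W Z : R * R -> R) (q v : R * R) (dU dV dW dZ u0 v0 w0 z0 : R).
Hypotheses (hU : is_derive q v U dU) (hV : is_derive q v V dV).
Hypotheses (hW : is_derive q v W dW) (hZ : is_derive q v Z dZ).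
Hypotheses (Uq : U q = u0) (Vq : V q = v0) (Wq : W q = w0) (Zq : Z q = z0).

Lemma is_derive_MDM : is_derive q v (U * V + W * Z)
  (u0 * dV + v0 * dU + (w0 * dZ + z0 * dW)).
Proof. by rewrite -Uq -Vq -Wq -Zq; apply: is_deriveD. Qed.

Lemma is_derive_MBM : is_derive q v (U * V - W * Z)
  (u0 * dV + v0 * dU - (w0 * dZ + z0 * dW)).
Proof. by rewrite -Uq -Vq -Wq -Zq; apply: is_deriveB. Qed.

End RealProducts.

Lemma is_cderiveM v f f' g g' : is_cderive v f g -> is_cderive v f' g' ->
  is_cderive v (f * f') (g * f' + f * g').
Proof.
move=> H H' p; have [hr hi] := H p; have [hr' hi'] := H' p.
(* Extension by 0 respects these operations: outside the half-plane both sides are 0. *)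
have -> : extend (Re_fun (f * f')) =
    extend (Re_fun f) * extend (Re_fun f') - extend (Im_fun f) * extend (Im_fun f').
  apply/funext => q; rewrite /extend !fctE; case: insub => [z|] /=.
    by rewrite /Re_fun /Im_fun ?fctE; case: (f z) (f' z) => ? ? [].
  by rewrite mulr0 subrr.
have -> : extend (Im_fun (f * f')) =
    extend (Re_fun f) * extend (Im_fun f') + extend (Im_fun f) * extend (Re_fun f').
  apply/funext => q; rewrite /extend !fctE; case: insub => [z|] /=.
    by rewrite /Re_fun /Im_fun ?fctE; case: (f z) (f' z) => ? ? [].
  by rewrite mulr0 addr0.
have Er := extendE (Re_fun f) p; have Ei := extendE (Im_fun f) p.
have Er' := extendE (Re_fun f') p; have Ei' := extendE (Im_fun f') p.
split; [apply: is_derive_eq (is_derive_MBM hr hr' hi hi' Er Er' Ei Ei') _ |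
        apply: is_derive_eq (is_derive_MDM hr hi' hi hr' Er Ei' Ei Er') _].
  rewrite !fctE /Re_fun /Im_fun.
  by case: (f p) (f' p) (g p) (g' p) => [? ?] [? ?] [? ?] [? ?] /=; ring.
rewrite !fctE /Re_fun /Im_fun.
by case: (f p) (f' p) (g p) (g' p) => [? ?] [? ?] [? ?] [? ?] /=; ring.
Qed.

Lemma is_cderiveD v f f' g g' : is_cderive v f g -> is_cderive v f' g' ->
  is_cderive v (f + f') (g + g').
Proof.
move=> H H' p; have [hr hi] := H p; have [hr' hi'] := H' p.
have -> : extend (Re_fun (f + f')) = extend (Re_fun f) + extend (Re_fun f').
  apply/funext => q; rewrite /extend !fctE; case: insub => [z|] /=.
    by rewrite /Re_fun ?fctE; case: (f z) (f' z) => ? ? [].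
  by rewrite addr0.
have -> : extend (Im_fun (f + f')) = extend (Im_fun f) + extend (Im_fun f').
  apply/funext => q; rewrite /extend !fctE; case: insub => [z|] /=.
    by rewrite /Im_fun ?fctE; case: (f z) (f' z) => ? ? [].
  by rewrite addr0.
by split; apply: is_derive_eq; rewrite !fctE; case: (g p) (g' p) => [? ?] [? ?].
Qed.

Lemma is_cderive_extend v f (U V dU dV : R * R -> R) :
  (forall p, f p = U (val p) +i* V (val p)) ->
  (forall p, is_derive (val p) v U (dU (val p))) ->
  (forall p, is_derive (val p) v V (dV (val p))) ->
  is_cderive v f (fun p => dU (val p) +i* dV (val p)).
Proof.
move=> fUV dUp dVp p; split.
  by apply: is_derive_extend (dUp p) => q; rewrite /Re_fun fUV.
by apply: is_derive_extend (dVp p) => q; rewrite /Im_fun fUV.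
Qed.

Lemma is_cderive_cst v a : is_cderive v (cst a) 0.
Proof.
move=> p; split.
  apply: (@is_derive_extend _ _ (cst (complex.Re a))) => //; exact: is_derive_cst.
apply: (@is_derive_extend _ _ (cst (complex.Im a))) => //; exact: is_derive_cst.
Qed.

Lemma is_cderiveZ v a f g : is_cderive v f g -> is_cderive v (a *: f) (a *: g).
Proof.
move=> H; have := is_cderiveM (is_cderive_cst v a) H.
by rewrite mul0r add0r.
Qed.

Definition lnx1 : F := fun p => (ln (x1 p))%:C.
Definition cx1 : F := fun p => (x1 p)%:C.
Definition cx2 : F := fun p => (x2 p)%:C.

Lemma x1_gt0 p : 0 < x1 p.
Proof. exact: (valP p). Qed.

Lemma cx1_neq0 p : cx1 p != 0.
Proof. by rewrite eq_complex /= eqxx andbT gt_eqF // x1_gt0. Qed.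

Lemma fscalerAl a f g : a *: f * g = a *: (f * g).
Proof. by apply/funext => p; rewrite !fctE /GRing.scale /= mulrA. Qed.

Lemma fscalerAr a f g : f * (a *: g) = a *: (f * g).
Proof. by rewrite mulrC fscalerAl mulrC. Qed.

(** The graph of the pair ([d2], [X]), including existence of both partial derivatives; [g1] is the
    derivative in [x1]. Both operators are derivations, so they are computed together by linearity
    and the Leibniz rule. *)
Definition is_DX f g h := exists g1,
  [/\ is_cderive (e1 R) f g1, is_cderive (e2 R) f g & h = cx1 * g1 + cx2 * g].

Lemma is_DX_eq f g h : is_DX f g h -> d2 f = g /\ Xop f = h.
Proof.
move=> [g1 [H1 H2 ->]]; rewrite /d2 /Xop.
by rewrite (is_cderive_cpderiv H1) (is_cderive_cpderiv H2).
Qed.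

Lemma csmooth_is_DX f : csmooth f -> is_DX f (d2 f) (Xop f).
Proof.
move=> [hr hi]; have [_ [r1 r2 _ _]] := hr 1%N; have [_ [i1 i2 _ _]] := hi 1%N.
by exists (cpderiv (e1 R) f); split=> //; apply: is_cderive_has_pderiv.
Qed.

Lemma is_DX0 : is_DX 0 0 0.
Proof.
exists 0; split; [exact: is_cderive_cst|exact: is_cderive_cst|].
by rewrite !mulr0 addr0.
Qed.

Lemma is_DXP a f f' g g' h h' : is_DX f g h -> is_DX f' g' h' ->
  is_DX (a *: f + f') (a *: g + g') (a *: h + h').
Proof.
move=> [g1 [H1 H2 ->]] [g1' [H1' H2' ->]]; exists (a *: g1 + g1'); split.
- by apply: is_cderiveD H1'; apply: is_cderiveZ.
- by apply: is_cderiveD H2'; apply: is_cderiveZ.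
- apply/funext => p; rewrite !fctE /GRing.scale /=; ring.
Qed.

Lemma is_DXZ a f g h : is_DX f g h -> is_DX (a *: f) (a *: g) (a *: h).
Proof. by move=> H; have := is_DXP a H is_DX0; rewrite !addr0. Qed.

Lemma is_DXM f f' g g' h h' : is_DX f g h -> is_DX f' g' h' ->
  is_DX (f * f') (g * f' + f * g') (h * f' + f * h').
Proof.
move=> [g1 [H1 H2 ->]] [g1' [H1' H2' ->]]; exists (g1 * f' + f * g1'); split.
- exact: is_cderiveM.
- exact: is_cderiveM.
- ring.
Qed.

Lemma is_DX_x1 f (u v du dv : R -> R) : (forall p, f p = u (x1 p) +i* v (x1 p)) ->
  (forall s : R, 0 < s -> is_derive s 1 u (du s)) ->
  (forall s : R, 0 < s -> is_derive s 1 v (dv s)) ->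
  is_DX f 0 (fun p => cx1 p * (du (x1 p) +i* dv (x1 p))).
Proof.
move=> fuv Hu Hv; exists (fun p => du (x1 p) +i* dv (x1 p)); split.
- apply: (is_cderive_extend (U := fun q => u q.1) (V := fun q => v q.1)
    (dU := fun q => du q.1) (dV := fun q => dv q.1)) => // p;
  have [s [t [s0 ->]]] := pointE p; apply/is_derive_slice1; [exact: Hu|exact: Hv].
- apply: (is_cderive_extend (U := fun q => u q.1) (V := fun q => v q.1)
    (dU := fun q => 0) (dV := fun q => 0)) => // p;
  have [s [t [s0 ->]]] := pointE p; apply/is_derive_slice2;
  [exact: (is_derive_cst (u s))|exact: (is_derive_cst (v s))].
- by rewrite mulr0 addr0.
Qed.

Lemma is_DX_x2 : is_DX cx2 1 cx2.
Proof.
exists 0; split; last by rewrite mulr0 add0r mulr1.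
- apply: (is_cderive_extend (U := fun q => q.2) (V := fun q => 0)
    (dU := fun q => 0) (dV := fun q => 0)) => // p;
  have [s [t [s0 ->]]] := pointE p; apply/is_derive_slice1;
  first [exact: (is_derive_cst t)|exact: is_derive_cst].
- apply: (is_cderive_extend (U := fun q => q.2) (V := fun q => 0)
    (dU := fun q => 1) (dV := fun q => 0)) => // p;
  have [s [t [s0 ->]]] := pointE p; apply/is_derive_slice2;
  first [exact: is_derive_id|exact: is_derive_cst].
Qed.

Lemma is_DX_ln : is_DX lnx1 0 1.
Proof.
have := @is_DX_x1 lnx1 (@ln R) (fun=> 0) (fun s => s^-1) (fun=> 0).
rewrite (_ : (fun p => _) = 1); last first.
  apply/funext => p; transitivity (1 : C) => //; apply/eqP; rewrite eq_complex /=.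
  by rewrite !mulr0 mul0r subr0 addr0 divff ?eqxx // gt_eqF // x1_gt0.
by apply.
Qed.

Lemma is_DX_x1pow a : is_DX (x1pow a) 0 (a *: x1pow a).
Proof.
case: a => al be.
set u := fun s => expR (al * ln s) * cos (be * ln s).
set v := fun s => expR (al * ln s) * sin (be * ln s).
(* With [a = al + i be], the two derivatives are the real and imaginary parts of [a * s^a / s]. *)
have := @is_DX_x1 (x1pow (al +i* be)) u v
  (fun s => (al * u s - be * v s) / s) (fun s => (al * v s + be * u s) / s).
have E p : x1pow (al +i* be) p = u (x1 p) +i* v (x1 p).
  rewrite /x1pow /cexp /u /v /=.
  by rewrite !mulr0 subr0 add0r.
rewrite (_ : (fun p => _ * _) = (al +i* be) *: x1pow (al +i* be)); last first.
  apply/funext => p; rewrite fctE E; apply/eqP; rewrite eq_complex /=.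
  have p0 : x1 p != 0 by rewrite gt_eqF // x1_gt0.
  by apply/andP; split; apply/eqP; field.
have lin (c s : R) : 0 < s -> is_derive s 1 (fun s : R => c * ln s) (c / s).
  by move=> s0; have := is_derive1_ln s0 => H; apply: is_derive_eq;
    rewrite /GRing.scale /=; ring.
apply=> // s s0; have Ha := lin al s s0; have Hb := lin be s s0.
  apply: is_derive_eq.
  rewrite /u /v /GRing.scale /=; field; exact: lt0r_neq0.
apply: is_derive_eq.
rewrite /u /v /GRing.scale /=; field; exact: lt0r_neq0.
Qed.

Lemma cexpD (z w : C) : cexp (z + w) = cexp z * cexp w.
Proof.
case: z w => a b [c d]; rewrite /cexp /= expRD sinD cosD.
by apply/eqP; rewrite eq_complex /=; apply/andP; split; apply/eqP; ring.
Qed.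

Lemma cexp0 : cexp 0 = 1 :> C.
Proof. by rewrite /cexp /= expR0 cos0 sin0 mul1r mulr0. Qed.

Lemma x1powD a b : x1pow (a + b) = x1pow a * x1pow b :> F.
Proof. by apply/funext => p; rewrite /x1pow mulrDl cexpD. Qed.

Lemma x1pow0 : x1pow 0 = 1 :> F.
Proof. by apply/funext => p; rewrite /x1pow mul0r cexp0. Qed.

Lemma x1pow1 : x1pow 1 = cx1 :> F.
Proof.
apply/funext => p; rewrite /x1pow mul1r /cexp /= cos0 sin0 mulr1 mulr0.
by rewrite lnK // posrE x1_gt0.
Qed.

(** Once [d2 f = 0], the equation [X f = 0] reads [x1 * g1 = 0]; as [x1] never vanishes, both
    partial derivatives are zero. *)
Lemma is_DX0_const f : is_DX f 0 0 -> exists c, f = cst c.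
Proof.
move=> [g1 [H1 H2 E]].
have g10 : g1 = 0.
  apply/funext => p; move/(congr1 (@^~ p)): E; rewrite !fctE mulr0 addr0.
  by move/esym/eqP; rewrite mulf_eq0 (negbTE (cx1_neq0 p)) => /eqP.
rewrite {}g10 in H1.
pose p0 : half_plane R := point 0 ltr01.
exists (f p0); apply/funext => p.
have Hr : Re_fun f p = Re_fun f p0.
  by apply: const_of_pderiv0 => q; [have [] := H1 q|have [] := H2 q].
have Hi : Im_fun f p = Im_fun f p0.
  by apply: const_of_pderiv0 => q; [have [] := H1 q|have [] := H2 q].
by apply/eqP; rewrite eq_complex; apply/andP; split; apply/eqP.
Qed.

(** By the Leibniz rule, multiplication by [x1pow (- a)] shifts the eigenvalue from [a] to 0, so the
    product is constant. *)
Lemma eigen_x1pow f a : is_DX f 0 (a *: f) -> exists c, f = c *: x1pow a.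
Proof.
move=> H; have := is_DXM (is_DX_x1pow (- a)) H.
rewrite mul0r mulr0 addr0 fscalerAl fscalerAr scaleNr addNr.
move=> /is_DX0_const[c E]; exists c.
have : x1pow a * (x1pow (- a) * f) = x1pow a * cst c by rewrite E.
rewrite mulrA -x1powD subrr x1pow0 mul1r => ->.
by apply/funext => p; rewrite !fctE mulrC.
Qed.

End ComplexOperators.

(** * Sums of monomials in [x1pow], [ln] and [x2], and integration within them *)

Section LogPolynomials.
Variable R : realType.
Local Notation C := R[i].
Local Notation F := (half_plane R -> R[i]).
Implicit Types (f g h : F) (p : half_plane R) (a b : C).

Lemma XopE f : Xop f = @cx1 R * cpderiv (e1 R) f + @cx2 R * d2 f.
Proof. by []. Qed.

(** The extra term [d2 f] comes from differentiating the coefficient [x2] of [X]; the rest is the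
    symmetry of mixed derivatives. *)
Lemma commutator_csmooth f : csmooth f -> csmooth (d2 f) ->
  d2 (Xop f) = Xop (d2 f) + d2 f.
Proof.
move=> [hr hi] s2.
have [_ [_ H2 _]] := csmooth_is_DX s2.
have [_ [r1 r2 [_ [_ r12 _ _]] [_ [_ r22 _ _]]]] := hr 2%N.
have [_ [i1 i2 [_ [_ i12 _ _]] [_ [_ i22 _ _]]]] := hi 2%N.
have H12 := @is_cderive_has_pderiv R (e2 R) (cpderiv (e1 R) f) r12 i12.
(* The coefficient [x1] is treated as [x1pow 1], whose derivative in [x2] is 0. *)
have [_ [_ X1 _]] := is_DX_x1pow (1 : C); have [_ [_ X2 _]] := is_DX_x2 R.
rewrite x1pow1 in X1.
have E := is_cderive_cpderiv (is_cderiveD (is_cderiveM X1 H12) (is_cderiveM X2 H2)).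
have S : cpderiv (e2 R) (cpderiv (e1 R) f) = cpderiv (e1 R) (d2 f).
  apply/funext => p; apply/eqP; rewrite eq_complex.
  by apply/andP; split; apply/eqP; apply: schwarz.
have A (x y u v w z : F) : 0 * u + x * v + (1 * w + y * z) = (x * v + y * z) + w.
  ring.
apply: (etrans E); apply: (etrans (A _ _ _ _ _ _)).
by rewrite S XopE.
Qed.

Lemma is_DX1 : is_DX 1 0 (0 : F).
Proof. by have := is_DX_x1pow (0 : C); rewrite x1pow0 scale0r. Qed.

Lemma is_DXX f g h n : is_DX f g h ->
  is_DX (f ^+ n) (n%:R *: (g * f ^+ n.-1)) (n%:R *: (h * f ^+ n.-1)).
Proof.
move=> H; elim: n => [|n IH]; first by rewrite expr0 !scale0r; exact: is_DX1.
have := is_DXM H IH; rewrite -exprS; congr is_DX.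
  case: n {IH} => [|n]; first by rewrite scale0r mulr0 addr0 scale1r.
  by rewrite fscalerAr mulrCA -exprS -[X in X + _]scale1r -scalerDl nat1r.
case: n {IH} => [|n]; first by rewrite scale0r mulr0 addr0 scale1r.
by rewrite fscalerAr mulrCA -exprS -[X in X + _]scale1r -scalerDl nat1r.
Qed.

Definition mono (t : C * nat * nat) : F :=
  x1pow t.1.1 * @lnx1 R ^+ t.1.2 * @cx2 R ^+ t.2.

Lemma monoE a i j p :
  mono (a, i, j) p = x1pow a p * lnx1 p ^+ i * cx2 p ^+ j.
Proof.
have E f n : (f ^+ n) p = f p ^+ n by elim: n => // n IH; rewrite !exprS -IH.
by rewrite /mono -!E.
Qed.

(** [X] has eigenvalue [a] on [x1pow a] and 1 on [x2], and sends the logarithm to 1. The truncated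
    predecessors at 0 are harmless, since their coefficients vanish. *)
Lemma is_DX_mono a i j : is_DX (mono (a, i, j)) (j%:R *: mono (a, i, j.-1))
  ((a + j%:R) *: mono (a, i, j) + i%:R *: mono (a, i.-1, j)).
Proof.
have := is_DXM (is_DXM (is_DX_x1pow a) (is_DXX i (is_DX_ln R))) (is_DXX j (is_DX_x2 R)).
congr is_DX.
  by rewrite !(mul0r, mulr0, scaler0, add0r, mul1r) fscalerAr.
rewrite /mono /= mul1r !(fscalerAl, fscalerAr) mulrDl !(fscalerAl, fscalerAr).
rewrite scalerDl addrAC; congr (_ + _ + _).
by case: j => [|j]; rewrite ?scale0r // -exprS.
Qed.

Section Span.
Variables (T : Type) (m : T -> F).

(** Indices may repeat in the list, so a sum of combinations is a concatenation and proofs go by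
    induction on the list. *)
Definition lspan f := exists l : seq (C * T), f = \sum_(x <- l) x.1 *: m x.2.

Lemma lspan0 : lspan 0.
Proof. by exists [::]; rewrite big_nil. Qed.

Lemma lspan_ind (P : F -> Prop) : P 0 ->
  (forall c t f, P f -> P (c *: m t + f)) -> forall f, lspan f -> P f.
Proof.
move=> P0 PS f [l ->]; elim: l => [|x l IH]; first by rewrite big_nil.
by rewrite big_cons; apply: PS.
Qed.

Lemma lspanP a f g : lspan f -> lspan g -> lspan (a *: f + g).
Proof.
move=> [l ->] [l' ->]; exists ([seq (a * x.1, x.2) | x <- l] ++ l').
rewrite big_cat big_map /= scaler_sumr; congr (_ + _).
by apply: eq_bigr => x _; rewrite scalerA.
Qed.

Lemma lspan_mem t : lspan (m t).
Proof. by exists [:: (1, t)]; rewrite big_seq1 scale1r. Qed.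

Lemma lspanZ a f : lspan f -> lspan (a *: f).
Proof. by move=> /(lspanP a) /(_ lspan0); rewrite addr0. Qed.

Lemma lspanD f g : lspan f -> lspan g -> lspan (f + g).
Proof. by move=> Hf Hg; rewrite -[f]scale1r; apply: lspanP. Qed.

End Span.

Definition logpoly := lspan mono.
Definition logpoly1 := lspan (fun t : C * nat => mono (t, 0)).

Lemma logpoly_DX f : logpoly f ->
  [/\ is_DX f (d2 f) (Xop f), logpoly (d2 f), logpoly (Xop f) &
      is_DX (Xop f) (Xop (d2 f) + d2 f) (Xop (Xop f))].
Proof.
(* The induction carries the images [g], [h] of [f] and [g'], [h'] of [g] as explicit witnesses,
   which [is_DX_eq] later identifies. The commutation relation is thereby checked monomial by
   monomial. *)
have key : logpoly f -> exists g h g' h', [/\ is_DX f g h, logpoly g, logpoly h,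
    is_DX g g' h' & exists h'', is_DX h (h' + g) h''].
  move: f; apply: lspan_ind => [|c [[a i] j] f [g [h [g' [h' [H1 H2 H3 H4 [h'' H5]]]]]]].
    exists 0, 0, 0, 0; split; rewrite ?add0r; try exact: is_DX0; try exact: lspan0.
    by exists 0; exact: is_DX0.
  have D := is_DX_mono.
  do 4!eexists; split.
  - exact: is_DXP (D _ _ _) H1.
  - by apply: lspanP => //; apply/lspanZ/lspan_mem.
  - apply: lspanP => //; apply: lspanP; [exact: lspan_mem|apply/lspanZ/lspan_mem].
  - apply: is_DXP H4; apply: is_DXZ; exact: D.
  - eexists; have := is_DXP c
      (is_DXP (a + j%:R) (D a i j) (is_DXZ i%:R (D a i.-1 j))) H5.
    congr is_DX.
    rewrite addrACA -!scalerDr; congr (_ *: _ + _).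
    apply/funext => p; rewrite !fctE /GRing.scale /=.
    case: j => [|j] /=; first by rewrite !(mul0r, mulr0, addr0).
    by rewrite -natr1; ring.
move=> /key [g [h [g' [h' [H1 H2 H3 H4 [h'' H5]]]]]].
have [E1 E2] := is_DX_eq H1; have [E3 E4] := is_DX_eq H4; have [E5 E6] := is_DX_eq H5.
by rewrite E1 E2 E4 E6; split.
Qed.
Lemma logpoly_const2 f : logpoly f -> d2 f = 0 -> logpoly1 f.
Proof.
move=> Mf Df; have [[_ [_ D _]] _ _ _] := logpoly_DX Mf.
rewrite Df in D.
(* Being constant on vertical lines, [f] equals its restriction to [x2 = 0] read as a function of
   [x1]. On that line every monomial with [j > 0] vanishes. *)
have -> : f = fun p => f (point 0 (x1_gt0 p)).
  apply/funext => p; have [s [t [s0 pE]]] := pointE p.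
  have -> : point 0 (x1_gt0 p) = point 0 s0 by apply: val_inj; rewrite /= pE.
  rewrite pE; apply/eqP; rewrite eq_complex; apply/andP; split; apply/eqP.
    by apply: (@const_of_pderiv2_0 _ (Re_fun f)) => q; have [] := D q.
  by apply: (@const_of_pderiv2_0 _ (Im_fun f)) => q; have [] := D q.
move: f Mf {Df D}; apply: lspan_ind => [|c [[a i] j] f IH]; first exact: lspan0.
case: j => [|j].
  have := lspanP c (lspan_mem (fun t : C * nat => mono (t, 0)) (a, i)) IH.
  by congr lspan; apply/funext => p; rewrite !fctE !monoE.
rewrite (_ : (fun p => _) = fun p => f (point 0 (x1_gt0 p))) //.
apply/funext => p; rewrite !fctE monoE /=.
by rewrite /GRing.scale /= [cx2 _](_ : _ = 0) // exprS !(mul0r, mulr0) add0r.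
Qed.

(** Integration in [x2]: raise the exponent of [x2] by one and divide by the new exponent. *)
Lemma d2_surj f : logpoly f -> exists2 g, logpoly g & d2 g = f.
Proof.
move: f; apply: lspan_ind => [|c [[a i] j] f [g Mg <-]].
  by exists 0; [exact: lspan0|have [] := is_DX_eq (is_DX0 R)].
exists ((c / j.+1%:R) *: mono (a, i, j.+1) + g).
  by apply: lspanP => //; exact: lspan_mem.
have [D _ _ _] := logpoly_DX Mg.
have [-> _] := is_DX_eq (is_DXP (c / j.+1%:R) (is_DX_mono a i j.+1) D).
by rewrite scalerA divfK // pnatr_eq0.
Qed.

(** This solves [(X - a) k = x1^b (log x1)^i]. In the resonant case [b = a], one more logarithm is
    needed. Otherwise [X - a] multiplies the leading monomial by [b - a] and adds a lower power of
    the logarithm, removed by induction on [i]. *)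
Lemma Xop_shift_mono a b i :
  exists2 k, logpoly k & is_DX k 0 (a *: k + mono (b, i, 0)).
Proof.
have D := is_DX_mono.
have D0 c i' : is_DX (mono (c, i', 0)) 0
    (c *: mono (c, i', 0) + i'%:R *: mono (c, i'.-1, 0)).
  by have := D c i' 0; rewrite scale0r addr0.
have [->|ne] := eqVneq b a.
  exists (i.+1%:R^-1 *: mono (a, i.+1, 0)); first by apply/lspanZ/lspan_mem.
  have := is_DXZ i.+1%:R^-1 (D0 a i.+1); congr is_DX; first by rewrite scaler0.
  by rewrite scalerDr !scalerA mulVf ?pnatr_eq0 // scale1r mulrC.
have ba : b - a != 0 by rewrite subr_eq0.
elim: i => [|i [k Mk Dk]].
  exists ((b - a)^-1 *: mono (b, 0, 0)); first by apply/lspanZ/lspan_mem.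
  have := is_DXZ (b - a)^-1 (D0 b 0); congr is_DX; first by rewrite scaler0.
  apply/funext => p; rewrite !fctE /GRing.scale /=.
  by move: (mono _ p) => u; field.
exists ((b - a)^-1 *: (- i.+1%:R *: k + mono (b, i.+1, 0))).
  by apply/lspanZ/lspanP => //; exact: lspan_mem.
have := is_DXZ (b - a)^-1 (is_DXP (- i.+1%:R) Dk (D0 b i.+1)); congr is_DX.
  by rewrite !(scaler0, addr0).
apply/funext => p; rewrite !fctE /GRing.scale /=.
by move: (mono _ p) (mono _ p) (k p) => u w z; field.
Qed.

Lemma Xop_shift_surj a f : logpoly1 f ->
  exists2 k, logpoly k & is_DX k 0 (a *: k + f).
Proof.
move: f; apply: lspan_ind => [|c [b i] f [k Mk Dk]].
  by exists 0; [exact: lspan0|rewrite scaler0 addr0; exact: is_DX0].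
have [k' Mk' Dk'] := Xop_shift_mono a b i.
exists (c *: k' + k); first by apply: lspanP.
have := is_DXP c Dk' Dk; congr is_DX; first by rewrite scaler0 addr0.
by rewrite !scalerDr addrACA !scalerA mulrC.
Qed.

(** Choose [g] in [logpoly] with [d2 g = d2 f] and put [k = f - g], so [d2 k = 0]. Then
    [m = (X - a) k] lies in [logpoly] and, by the commutation relation, [d2 m = 0], so
    [m = (X - a) h] with [h] in [logpoly] and [d2 h = 0]. The difference [k - h] is a multiple of
    [x1pow a], whence [f] is in [logpoly]. *)
Lemma logpoly_absorb f a : csmooth f -> csmooth (d2 f) -> csmooth (Xop f) ->
  logpoly (d2 f) -> logpoly (Xop f - a *: f) -> logpoly f.
Proof.
move=> sf s2 sX M2 MX.
have Df := csmooth_is_DX sf; have DX := csmooth_is_DX sX.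
rewrite (commutator_csmooth sf s2) in DX.
have [g Mg Eg] := d2_surj M2; have [Dg Mg2 MgX DgX] := logpoly_DX Mg.
rewrite Eg in Dg DgX.
have Dk := is_DXP (-1) Dg Df.
set k := -1 *: g + f in Dk; set hk := -1 *: Xop g + Xop f in Dk.
have Dm := is_DXP (- a) Dk (is_DXP (-1) DgX DX).
set m := - a *: k + hk in Dm.
have Mm : logpoly m.
  have -> : m = -1 *: (- a *: g + Xop g) + (Xop f - a *: f).
    rewrite /m /hk /k; move: (Xop f) (Xop g) => u w.
    by apply/funext => p; rewrite !fctE /GRing.scale /=;
      move: (u p) (w p) (f p) (g p) => *; ring.
  by apply: lspanP => //; apply: lspanP.
have m0 : d2 m = 0.
  have [-> _] := is_DX_eq Dm.
  by rewrite !scaleN1r !addNr scaler0 add0r.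
have [h Mh Dh] := Xop_shift_surj a (logpoly_const2 Mm m0).
have Dq := is_DXP (-1) Dh Dk.
have [] := @eigen_x1pow R (-1 *: h + k) a.
  move: Dq; congr is_DX; first by rewrite !scaleN1r addNr oppr0 addr0.
  rewrite /m; move: (hk) (k) => u w.
  by apply/funext => p; rewrite !fctE /GRing.scale /=; move: (u p) (w p) (h p) => *; ring.
move=> c E; have -> : f = c *: x1pow a + (h + g).
  by rewrite -E /k !scaleN1r addrACA addNr add0r addrAC addNr add0r.
apply: lspanP; last exact: lspanD.
by have := lspan_mem mono (a, 0, 0); rewrite /mono /= !expr0 !mulr1.
Qed.

End LogPolynomials.

(** * Linear algebra of spans, and eigenvectors modulo a stable subspace *)

Section Submodules.
Variable R : realType.
Local Notation C := R[i].
Local Notation F := (half_plane R -> R[i]).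
Implicit Types (f g h : F) (E S : set F) (s : seq F) (a b c : C).

(** Coefficients form a row vector, so a linear map on the span acts by right multiplication with a
    matrix. *)
Definition comb s (v : 'rV[C]_(size s)) : F := \sum_i v 0 i *: s`_i.

Lemma CspanP s f : Cspan s f <-> exists v, f = comb (s := s) v.
Proof.
split=> [[c ->]|[v ->]]; last by exists (v 0).
by exists (\row_i c i); apply: eq_bigr => i _; rewrite mxE.
Qed.

Lemma CfreeP s : Cfree s <-> forall v, comb (s := s) v = 0 -> v = 0.
Proof.
split=> [H v /H v0|H c c0 i]; first by apply/rowP => i; rewrite v0 mxE.
have : comb (s := s) (\row_i c i) = 0.
  by rewrite -c0; apply: eq_bigr => j _; rewrite mxE.
by move/H/rowP/(_ i); rewrite !mxE.
Qed.

Lemma comb_mul s n (v : 'rV[C]_n) (A : 'M[C]_(n, size s)) :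
  \sum_i v 0 i *: comb (row i A) = comb (v *m A).
Proof.
rewrite /comb; under eq_bigr => i _ do rewrite scaler_sumr.
rewrite exchange_big; apply: eq_bigr => j _; rewrite mxE scaler_suml.
by apply: eq_bigr => i _; rewrite mxE scalerA.
Qed.

Lemma comb_linear s a (v w : 'rV[C]_(size s)) :
  comb (a *: v + w) = a *: comb v + comb w.
Proof.
rewrite /comb scaler_sumr -big_split; apply: eq_bigr => i _ /=.
by rewrite !mxE scalerDl scalerA.
Qed.

Lemma comb0 s : comb (0 : 'rV[C]_(size s)) = 0.
Proof. by rewrite /comb big1 // => i _; rewrite mxE scale0r. Qed.

Lemma CspanPl s a f g : Cspan s f -> Cspan s g -> Cspan s (a *: f + g).
Proof.
move=> /CspanP[v ->] /CspanP[w ->]; apply/CspanP.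
by exists (a *: v + w); rewrite comb_linear.
Qed.

Lemma Cspan_0 s : Cspan s 0.
Proof. by apply/CspanP; exists 0; rewrite comb0. Qed.

(** Let [A] be the matrix expressing [s'] in terms of [s]. Freeness of [s'] makes [A] row free,
    which bounds its number of rows; when [A] is square it is also row full, so every combination of
    [s] is one of [s']. *)
Lemma Cfree_span s s' : Cfree s' -> (forall i : 'I_(size s'), Cspan s s'`_i) ->
  (size s' <= size s)%N /\ (size s' = size s -> Cspan s `<=` Cspan s').
Proof.
move=> /CfreeP fr sub.
have sub' (i : 'I_(size s')) : exists v, s'`_i = comb (s := s) v.
  by apply/CspanP; apply: sub.
pose A := \matrix_(i < size s') projT1 (cid (sub' i)).
have rowA (i : 'I_(size s')) : s'`_i = comb (row i A) by rewrite rowK; case: cid.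
have combA v : comb (s := s') v = comb (v *m A).
  by rewrite -comb_mul; apply: eq_bigr => i _; rewrite rowA.
have Afree : row_free A.
  by apply: inj_row_free => v vA; apply: fr; rewrite combA vA comb0.
split=> [|sz]; first by rewrite -(eqP Afree) rank_leq_col.
move=> f /CspanP[w ->]; apply/CspanP.
have Afull : row_full A by rewrite /row_full (eqP Afree) sz.
have /submxP[v ->] := submx_full w Afull.
by exists v; rewrite combA.
Qed.

Lemma Cfree_cons s g : Cfree s -> ~ Cspan s g -> Cfree (g :: s).
Proof.
move=> fr ng c; rewrite big_ord_recl /= => H.
have c0 : c ord0 = 0.
  apply/eqP; apply: contra_notT ng => c0.
  exists (fun i => - (c ord0)^-1 * c (lift ord0 i)).
  apply: (scalerI c0); move/eqP: H; rewrite addr_eq0 => /eqP ->.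
  rewrite scaler_sumr -sumrN.
  by apply: eq_bigr => i _; rewrite scalerA mulrA mulrN divff // mulN1r scaleNr.
rewrite c0 scale0r add0r in H => i.
by have [j ->|->//] := unliftP ord0 i; apply: (fr (fun j => c (lift ord0 j)) H).
Qed.

Lemma Cspan1P u f : Cspan [:: u] f <-> exists a, f = a *: u.
Proof.
split=> [[c ->]|[a ->]]; first by exists (c 0); rewrite big_ord1.
by exists (fun=> a); rewrite big_ord1.
Qed.

Lemma Cspan2P u v f : Cspan [:: u; v] f <-> exists a b, f = a *: u + b *: v.
Proof.
split=> [[c ->]|[a [b ->]]].
  by exists (c ord0), (c (lift ord0 ord0)); rewrite big_ord_recl big_ord1.
exists (fun i => if val i == 0%N then a else b).
by rewrite big_ord_recl big_ord1.
Qed.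

Lemma Cspan0P f : Cspan [::] f <-> f = 0.
Proof.
split=> [[c ->]|->]; [exact: big_ord0|exact: Cspan_0].
Qed.

Lemma Cfree_nil : Cfree ([::] : seq F).
Proof. by move=> c _ []. Qed.

Lemma Cdim_not_sub E n s : Cdim E n -> (size s < n)%N -> exists2 f, E f & ~ Cspan s f.
Proof.
move=> [s' [sz fr ->]] lt; apply: contrapT => H.
have [|+ _] := @Cfree_span s s' fr; last by rewrite sz leqNgt lt.
move=> i; apply: contrapT => ns; apply: H; exists s'`_i => //.
exists (fun j => (j == i)%:R); rewrite (bigD1 i) //= eqxx scale1r big1 ?addr0 //.
by move=> j /negbTE ->; rewrite scale0r.
Qed.

Lemma Cdim_eq_span E n s : Cdim E n -> size s = n -> Cfree s ->
  (forall i : 'I_(size s), E s`_i) -> E = Cspan s.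
Proof.
move=> [s' [sz fr' ->]] szn fr sub; apply/seteqP; split.
  by apply: (Cfree_span fr sub).2; rewrite sz szn.
move=> f [c ->]; apply: (big_ind (Cspan s')) => [|u v Hu Hv|i _].
- exact: Cspan_0.
- by rewrite -[u]scale1r; apply: CspanPl.
- by rewrite -[_ *: _]addr0; apply: CspanPl (Cspan_0 _).
Qed.

Lemma Bsubmodule_linear E c f g : Bsubmodule E -> E f -> E g -> E (c *: f + g).
Proof.
by move=> [[_ EP] _ _ _] Ef Eg; apply: set_mem; apply: EP; apply: mem_set.
Qed.

(** The product of the operators [X - a] for [a] in [r], the head of the list acting last. *)
Definition Xprod (r : seq C) f : F := foldr (fun a g => Xop g - a *: g) f r.

Lemma Xop_comb s (B : 'M[C]_(size s)) (v : 'rV[C]_(size s)) :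
  (forall i : 'I_(size s), is_DX s`_i (d2 s`_i) (comb (row i B))) ->
  Xop (comb v) = comb (v *m B).
Proof.
move=> H; rewrite -comb_mul.
suff : is_DX (comb v) (\sum_i v 0 i *: d2 s`_i) (\sum_i v 0 i *: comb (row i B)).
  by move/is_DX_eq => [].
rewrite /comb; elim/big_rec3: _ => [|i f g h _]; first exact: is_DX0.
exact: is_DXP.
Qed.

(* The roots are those of the characteristic polynomial of X on the span. *)
Lemma Xprod_annihilates s : (forall f, Cspan s f -> csmooth f) ->
  (forall f, Cspan s f -> Cspan s (Xop f)) ->
  exists r, forall f, Cspan s f -> Xprod r f = 0.
Proof.
case: s => [|u s'] sm stab; first by exists [::] => f /Cspan0P.
set s := u :: s' in sm stab *.
have mem (i : 'I_(size s)) : Cspan s s`_i.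
  exists (fun j => (j == i)%:R); rewrite (bigD1 i) //= eqxx scale1r big1 ?addr0 //.
  by move=> j /negbTE ->; rewrite scale0r.
have XB (i : 'I_(size s)) : exists v, Xop s`_i = comb (s := s) v.
  by apply/CspanP/stab/mem.
pose B : 'M[C]_(size s) := \matrix_i projT1 (cid (XB i)).
have HB (i : 'I_(size s)) : is_DX s`_i (d2 s`_i) (comb (row i B)).
  have := csmooth_is_DX (sm _ (mem i)).
  by rewrite rowK; case: cid => /= v ->.
have [r rE] := closed_field_poly_normal (char_poly B).
exists r => f /CspanP[v ->].
(* In coordinates [Xprod t] is the polynomial with roots [t] evaluated at [B]; for the roots of the
   characteristic polynomial, Cayley-Hamilton makes it zero. *)
have Xr t w : Xprod t (comb (s := s) w) =
    comb (s := s) (w *m horner_mx B (\prod_(a <- t) ('X - a%:P))).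
  elim: t => [|a t IH]; first by rewrite big_nil rmorph1 mulmx1.
  rewrite /= IH big_cons mulrC rmorphM /= rmorphB /= horner_mx_X horner_mx_C.
  rewrite mulmxA mulmxBr addrC -scaleNr (Xop_comb _ HB) -comb_linear.
  by rewrite mul_mx_scalar scaleNr addrC.
have := Cayley_Hamilton B; rewrite {1}rE (monicP (char_poly_monic B)) scale1r.
by rewrite Xr => ->; rewrite mulmx0 comb0.
Qed.

(** Modulo [S], [f] is an eigenvector of [X] for [a], so each factor [X - b] multiplies it by
    [a - b]. Membership in [E] is carried along because [S] is assumed stable under [X] only on
    [E]. *)
Lemma Xprod_mod E S r f a :
  Bsubmodule E -> (forall c u v, S u -> S v -> S (c *: u + v)) -> S 0 ->
  (forall u, E u -> S u -> S (Xop u)) ->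
  E f -> S (Xop f - a *: f) ->
  E (Xprod r f) /\ S (Xprod r f - (\prod_(b <- r) (a - b)) *: f).
Proof.
move=> EB SP S0 SX Ef Sf; have [_ sm _ EX] := EB.
have EP' c u v := @Bsubmodule_linear E c u v EB.
elim: r => [|b r [Eg Sg]].
  by rewrite big_nil scale1r subrr.
rewrite big_cons /=; set g := Xprod r f in Eg Sg *; set q := \prod_(_ <- _) _ in Sg *.
have Xg : E (Xop g - b *: g) by rewrite addrC -scaleNr; apply: EP' => //; exact: EX.
split=> //.
have EE : E (g - q *: f) by rewrite addrC -scaleNr; apply: EP'.
have DX : Xop (g - q *: f) = Xop g - q *: Xop f.
  have := is_DXP (- q) (csmooth_is_DX (sm _ Ef)) (csmooth_is_DX (sm _ Eg)).
  by move/is_DX_eq => [_]; rewrite !scaleNr ![- _ + _]addrC.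
(* [(X - b) g - (a - b) q f = q (X - a) f + (X - b) (g - q f)], and both terms on the right are in
   [S]. *)
have := SP q _ _ Sf (SP (- b) _ _ Sg (SX _ EE Sg)).
congr S; rewrite DX; move: (Xop g) (Xop f) => u v.
apply/funext => p; rewrite !fctE /GRing.scale /=.
by move: (u p) (v p) (f p) (g p) => *; ring.
Qed.

Lemma common_eigenvector_mod E S :
  Bsubmodule E -> Cfinite_dim E ->
  (forall c u v, S u -> S v -> S (c *: u + v)) -> S 0 ->
  (forall u, E u -> S u -> S (d2 u)) -> (forall u, E u -> S u -> S (Xop u)) ->
  (exists2 f, E f & ~ S f) ->
  exists g a, [/\ E g, ~ S g, S (d2 g) & S (Xop g - a *: g)].
Proof.
move=> EB [n [s [_ _ EE]]] SP S0 SD SX [f Ef nSf].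
have [_ sm ED EX] := EB.
have EP' c u v := @Bsubmodule_linear E c u v EB.
have [|| r rE] := @Xprod_annihilates s; rewrite -?EE //.
have EXr t u : E u -> E (Xprod t u).
  move=> Eu; elim: t => //= b t IH.
  by rewrite addrC -scaleNr; apply: EP' => //; exact: EX.
(* The factors of [Xprod r] lead from [f], outside [S], to 0. The last partial product outside [S]
   is an eigenvector modulo [S]. *)
have [g0 [a [Eg0 nSg0 Sg0]]] : exists g a, [/\ E g, ~ S g & S (Xop g - a *: g)].
  have : S (Xprod r f) by rewrite rE -?EE.
  elim: r {rE} => [//|b t IH] /= H.
  have [/IH//|nS] := pselect (S (Xprod t f)).
  by exists (Xprod t f), b; split=> //; exact: EXr.
pose g k := iter k (@d2 R) g0.
have Eg k : E (g k) by elim: k => //= k; apply: ED.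
(* Applying [d2] to the relation for [k] and commuting it past [X] lowers the eigenvalue by one. *)
have Sg k : S (Xop (g k) - (a - k%:R) *: g k).
  elim: k => [|k IH]; first by rewrite subr0.
  have Eu : E (Xop (g k) - (a - k%:R) *: g k).
    by rewrite addrC -scaleNr; apply: EP' => //; exact: EX.
  have := SD _ Eu IH; congr S.
  have := is_DXP (- (a - k%:R)) (csmooth_is_DX (sm _ (Eg k)))
    (csmooth_is_DX (sm _ (EX _ (Eg k)))).
  rewrite scaleNr [X in is_DX X]addrC => /is_DX_eq[-> _].
  rewrite (commutator_csmooth (sm _ (Eg k)) (sm _ (ED _ (Eg k)))) -/(g k.+1).
  rewrite scaleNr addrC -addrA; congr (_ + _).
  rewrite -[X in X - _]scale1r -scalerBl -scaleNr; congr (_ *: _).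
  by rewrite -natr1; ring.
have [k Sk] : exists k, S (g k).
  apply: contrapT => nS.
  (* [Xprod r] kills [g k], and modulo [S] it multiplies [g k] by the product of the [a - k - b].
     Were that product nonzero, [g k] would lie in [S]. *)
  have roots k : a - k%:R \in r.
    apply: contra_notT nS => nr; exists k.
    have [_] := Xprod_mod r EB SP S0 SX (Eg k) (Sg k).
    have : \prod_(b <- r) (a - k%:R - b) != 0.
      rewrite prodf_seq_neq0; apply/allP => b br /=; rewrite subr_eq0.
      by apply: contraNneq nr => ->.
    set q := \prod_(b <- r) _ => q0.
    rewrite rE -?EE // sub0r -scaleNr => /(SP (- q^-1))/(_ S0).
    by rewrite addr0 scalerA mulrNN mulVf // scale1r.
  (* Pigeonhole: in characteristic zero the [a - k] are distinct, and one more of them than the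
     length of [r] would all be members of [r]. *)
  have : (size [seq (a - k%:R)%R | k <- iota 0 (size r).+1] <= size r)%N.
    apply: uniq_leq_size => [|_ /mapP[k _ ->] //].
    rewrite map_inj_uniq ?iota_uniq // => k l /addrI/oppr_inj/eqP.
    by rewrite eqr_nat => /eqP.
  by rewrite size_map size_iota ltnn.
(* Descending from an iterate in [S] to [g 0], which is outside, yields some [g k] outside [S] with
   [d2 (g k)] in [S]. *)
elim: k Sk => [/nSg0 //|k IH] Sk.
have [/IH//|nS] := pselect (S (g k)).
by exists (g k), (a - k%:R); split.
Qed.

End Submodules.

(** * From common eigenvectors to explicit bases *)

Section Monomials.
Variables (R : realType).
Local Notation C := R[i].
Local Notation F := (half_plane R -> R[i]).
Implicit Types (f g h : F) (E : set F) (a b c : C).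

Lemma logpoly_coef f : logpoly f ->
  exists (s : seq (C * nat * nat)) (c : C -> nat -> nat -> C), uniq s /\
    forall p, f p = \sum_(t <- s) c t.1.1 t.1.2 t.2 * x1pow t.1.1 p *
                      (ln (x1 p))%:C ^+ t.1.2 * (x2 p)%:C ^+ t.2.
Proof.
(* The list [l] may repeat exponents: duplicates are removed, and the coefficient of an exponent is
   the sum over all its occurrences. *)
move=> [l ->]; exists (undup [seq x.2 | x <- l]).
exists (fun a i j => \sum_(x <- l | x.2 == (a, i, j)) x.1); split.
  exact: undup_uniq.
move=> p; rewrite fct_sumE (eq_bigr (fun x : C * (C * nat * nat) => x.1 * mono x.2 p)) //.
transitivity (\sum_(t <- undup [seq x.2 | x <- l])
  (\sum_(x <- l | x.2 == t) x.1) * mono t p).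
  under [RHS]eq_bigr => t _ do rewrite mulr_suml.
  rewrite (exchange_big_dep xpredT) //= big_seq [RHS]big_seq.
  apply: eq_bigr => x xl; rewrite -big_filter.
  have xm : x.2 \in undup [seq x.2 | x <- l] by rewrite mem_undup map_f.
  rewrite [X in _ = \sum_(_ <- X) _](_ : _ = [:: x.2]) ?big_seq1 //.
  rewrite (eq_filter (a2 := pred1 x.2)); last by move=> t; rewrite /= eq_sym.
  by rewrite filter_pred1_uniq ?undup_uniq.
by apply: eq_bigr => -[[a i] j] _; rewrite monoE !mulrA.
Qed.

Lemma x1pow_neq0 a p : x1pow a p != 0.
Proof.
apply: contraTneq isT => p0; have := congr1 (@^~ p) (x1powD a (- a)).
by rewrite subrr x1pow0 !fctE p0 mul0r => /eqP; rewrite oner_eq0.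
Qed.

Lemma x1pow_free a : Cfree [:: x1pow a : F].
Proof.
apply: (Cfree_cons (@Cfree_nil R)) => /Cspan0P/(congr1 (@^~ (point 0 ltr01))).
by move/eqP; rewrite (negbTE (x1pow_neq0 a _)).
Qed.

(** If [E] had an element outside [logpoly], a common eigenvector modulo [logpoly] would exist
    outside it, contrary to [logpoly_absorb]. *)
Lemma Bsubmodule_logpoly E : Bsubmodule E -> Cfinite_dim E -> E `<=` @logpoly R.
Proof.
move=> EB fin f Ef; apply: contrapT => nf.
have [_ sm ED EX] := EB.
have [|||||g [a [Eg ng M2 MX]]] := @common_eigenvector_mod R E (@logpoly R) EB fin.
- exact: lspanP.
- exact: lspan0.
- by move=> u _ /logpoly_DX[].
- by move=> u _ /logpoly_DX[].
- by exists f.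
by apply: ng; apply: logpoly_absorb M2 MX; apply: sm; auto.
Qed.

(** With [S = 0] the common eigenvector is a genuine one, hence a nonzero multiple of some
    [x1pow a]. *)
Lemma Bsubmodule_x1pow E n : Bsubmodule E -> Cdim E n.+1 ->
  exists a, E (x1pow a).
Proof.
move=> EB dimE; have [[E0 _] sm _ _] := EB.
have [|||||g [a [Eg ng D0 XE]]] :=
    @common_eigenvector_mod R E (Cspan [::]) EB (ex_intro _ _ dimE).
- by move=> *; apply: CspanPl.
- exact: Cspan_0.
- by move=> u _ /Cspan0P ->; have [-> _] := is_DX_eq (is_DX0 R); apply: Cspan_0.
- by move=> u _ /Cspan0P ->; have [_ ->] := is_DX_eq (is_DX0 R); apply: Cspan_0.
- exact: Cdim_not_sub dimE _.
have Dg := csmooth_is_DX (sm _ Eg).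
move: D0 XE => /Cspan0P D0 /Cspan0P/eqP; rewrite subr_eq0 => /eqP X0.
rewrite D0 X0 in Dg; have [c gE] := eigen_x1pow Dg.
exists a; have c0 : c != 0.
  by apply: contra_notN ng => /eqP c0; apply/Cspan0P; rewrite gE c0 scale0r.
have -> : x1pow a = c^-1 *: g + 0 by rewrite gE scalerA mulVf // scale1r addr0.
by apply: Bsubmodule_linear => //; apply: set_mem.
Qed.

Lemma Cspan2_change u v w (a b : C) : a != 0 -> v = a *: w + b *: u :> F ->
  Cspan [:: u; v] = Cspan [:: u; w].
Proof.
move=> a0 ->; apply/seteqP; split=> f /Cspan2P[x [y ->]]; apply/Cspan2P.
  exists (x + y * b), (y * a).
  by rewrite scalerDr !scalerA scalerDl -addrA; congr (_ + _); rewrite addrC.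
exists (x - y / a * b), (y / a).
by rewrite scalerDr !scalerA divfK // scalerBl addrCA subrK addrC.
Qed.

(** The system is [d2 g = c x1^a], [X g = b g + d x1^a]. The three outcomes are [c != 0], then
    [c = 0] with [b = a], then [c = 0] with [b != a]. In each, subtracting a particular solution
    leaves a multiple of [x1pow b]. *)
Lemma two_dim_normal_form g a b c d :
  is_DX g (c *: x1pow a) (b *: g + d *: x1pow a) ->
  d2 (Xop g) = Xop (d2 g) + d2 g -> ~ Cspan [:: x1pow a] g ->
  exists k e, k != 0 /\
  [\/ exists c1, g =
        k *: (fun p => x1pow a p * (c1 * (x1 p)%:C + (x2 p)%:C)) + e *: x1pow a,
      g = k *: (fun p => x1pow a p * (ln (x1 p))%:C) + e *: x1pow a |
      a <> b /\ g = k *: x1pow b + e *: x1pow a].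
Proof.
move=> Dg comm ng.
have Da := is_DX_x1pow a.
have [E1 E2] := is_DX_eq Dg.
(* The commutation relation applied to [g] reads [b c x1^a = (a + 1) c x1^a]; coefficients are
   compared at the point (1, 0), where [x1pow a] is nonzero. *)
have ab : c != 0 -> b = a + 1.
  move=> c0; move: comm; rewrite E2 E1.
  have [-> _] := is_DX_eq (is_DXP b Dg (is_DXZ d Da)).
  have [_ ->] := is_DX_eq (is_DXZ c Da).
  rewrite scaler0 addr0 !scalerA -scalerDl => /(congr1 (@^~ (point 0 ltr01))).
  move=> /(mulIf (x1pow_neq0 _ _)).
  have -> : c * a + c = (a + 1) * c by ring.
  exact: mulIf.
have [c0|c0] := eqVneq c 0; last first.
  have bE := ab c0.
  have D2 := is_DXM Da (is_DX_x2 R).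
  (* x1pow a * (c x2 - d) is a particular solution *)
  have Dk := is_DXP (- c) D2 (is_DXP d Da Dg).
  have [] := @eigen_x1pow R (- c *: (x1pow a * @cx2 R) + (d *: x1pow a + g)) (a + 1).
    move: Dk; congr is_DX.
      by rewrite scaler0 mul0r !add0r mulr1 scaleNr addNr.
    rewrite bE; apply/funext => p; rewrite !fctE /GRing.scale /=; ring.
  move=> e; rewrite x1powD x1pow1 => gE.
  exists c, (- d); split=> //; constructor 1; exists (e / c).
  have -> : g = (- c *: (x1pow a * @cx2 R) + (d *: x1pow a + g)) +
                (c *: (x1pow a * @cx2 R) - d *: x1pow a).
    apply/funext => p; rewrite !fctE /GRing.scale /=; ring.
  rewrite gE; apply/funext => p; rewrite !fctE /GRing.scale /= /cx1 /cx2.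
  by field.
rewrite c0 scale0r in Dg.
have [ba|ne] := eqVneq b a.
  rewrite ba in Dg.
  (* The particular solution is [d x1^a log x1], since [X - a] sends [x1^a log x1] to [x1^a]. *)
  have Dk := is_DXP (- d) (is_DXM Da (is_DX_ln R)) Dg.
  have [] := @eigen_x1pow R (- d *: (x1pow a * @lnx1 R) + g) a.
    move: Dk; congr is_DX; first by rewrite mul0r mulr0 !addr0 scaler0.
    apply/funext => p; rewrite !fctE /GRing.scale /=.
    have -> : (1 : F) p = 1 by []; ring.
  move=> e gE.
  have gE' : g = d *: (x1pow a * @lnx1 R) + e *: x1pow a.
    by rewrite -gE scaleNr addNKr.
  exists d, e; split; last by constructor 2.
  by apply: contra_notN ng => /eqP d0; apply/Cspan1P; exists e;
    rewrite gE' d0 scale0r add0r.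
have ba : b - a != 0 by rewrite subr_eq0.
(* The particular solution is [- d / (b - a) x1^a], since [X - b] multiplies [x1^a] by [a - b]. *)
have Dk := is_DXP (d / (b - a)) Da Dg.
have [] := @eigen_x1pow R ((d / (b - a)) *: x1pow a + g) b.
  move: Dk; congr is_DX; first by rewrite scaler0 addr0.
  apply/funext => p; rewrite !fctE /GRing.scale /=.
  by move: (x1pow a p) => u; field.
move=> k gE.
have gE' : g = k *: x1pow b + (- (d / (b - a))) *: x1pow a.
  by rewrite -gE scaleNr addrAC subrr add0r.
exists k, (- (d / (b - a))); split; last first.
  by constructor 3; split => // abE; rewrite abE eqxx in ne.
by apply: contra_notN ng => /eqP k0; apply/Cspan1P; eexists; rewrite gE' k0 scale0r add0r.
Qed.

End Monomials.

Theorem theorem1p12 (R : realType) (E : set (half_plane R -> R[i]))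
    (hE : Bsubmodule E) (hfin : Cfinite_dim E) :
  [/\ (forall f : half_plane R -> R[i], E f ->
         exists (s : seq (R[i] * nat * nat)) (c : R[i] -> nat -> nat -> R[i]),
           uniq s /\
           (forall p, f p = \sum_(t <- s) c t.1.1 t.1.2 t.2 * x1pow t.1.1 p *
                        (ln (x1 p))%:C ^+ t.1.2 * (x2 p)%:C ^+ t.2)),
      (Cdim E 1 ->
         exists a : R[i], E = Cspan [:: x1pow a]) &
      (Cdim E 2 ->
         exists alpha beta c1 : R[i],
         [\/ E = Cspan [:: x1pow alpha;
                   fun p => x1pow alpha p * (c1 * (x1 p)%:C + (x2 p)%:C)],
             E = Cspan [:: x1pow alpha;
                   fun p => x1pow alpha p * (ln (x1 p))%:C] |
             alpha <> beta /\
             E = Cspan [:: x1pow alpha; x1pow beta]])].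
Proof.
split=> [f /(Bsubmodule_logpoly hE hfin)|dimE|dimE]; first exact: logpoly_coef.
  have [a Ea] := Bsubmodule_x1pow hE dimE; exists a.
  apply: (Cdim_eq_span dimE) => // [|i]; first exact: x1pow_free.
  by rewrite ord1.
have [a Ea] := Bsubmodule_x1pow hE dimE.
have [_ sm ED EX] := hE.
(* With one basis vector [x1pow a] found, the second is a common eigenvector modulo its span. *)
have [|||||g [b [Eg ng Dg Xg]]] :=
    @common_eigenvector_mod R E (Cspan [:: x1pow a]) hE hfin.
- by move=> *; apply: CspanPl.
- exact: Cspan_0.
- move=> u _ /Cspan1P[e ->]; apply/Cspan1P; exists 0.
  have [-> _] := is_DX_eq (is_DXZ e (is_DX_x1pow a)).
  by rewrite scaler0 scale0r.
- move=> u _ /Cspan1P[e ->]; apply/Cspan1P; exists (e * a).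
  have [_ ->] := is_DX_eq (is_DXZ e (is_DX_x1pow a)).
  by rewrite scalerA.
- exact: Cdim_not_sub dimE _.
have EE : E = Cspan [:: x1pow a; g].
  rewrite (Cdim_eq_span dimE (s := [:: g; x1pow a])) //.
  - apply/seteqP; split=> f /Cspan2P[x [y ->]]; apply/Cspan2P;
    by exists y, x; rewrite addrC.
  - by apply: Cfree_cons => //; exact: x1pow_free.
  - by case=> -[|[|]].
move: Dg Xg => /Cspan1P[c Dg] /Cspan1P[d /eqP]; rewrite subr_eq addrC => /eqP Xg.
have comm := commutator_csmooth (sm _ Eg) (sm _ (ED _ Eg)).
have DXg := csmooth_is_DX (sm _ Eg); rewrite Dg Xg in DXg.
have [k [e [k0 nf]]] := two_dim_normal_form DXg comm ng.
(* As [k != 0], the normal form of [g] can replace [g] in the basis. [beta] is the eigenvalue [b] of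
   [g] modulo [x1pow a]; [c1] is a placeholder 0 in the last two cases. *)
exists a, b; case: nf => [[c1 gE]|gE|[ab gE]].
- by exists c1; constructor 1; rewrite EE (Cspan2_change k0 gE).
- by exists 0; constructor 2; rewrite EE (Cspan2_change k0 gE).
- by exists 0; constructor 3; rewrite EE (Cspan2_change k0 gE).
Qed.
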